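(* Let $\mathcal M^{\ell,q}_{\mathbb C}$ be the complex $q$-linked Minkowski space and $G=\mathrm{SL}_q^{(s)}(2,\mathbb C)\stackrel{\ell}{\oplus}\mathrm{SL}_q^{(s)}(2,\mathbb C)$ the complex $q$-linked Lorentz group (both defined in the context). Then the assignment $$\rho(t_{ij})=\sum_{s,r=1}^2 y_{is}\,S(x_{rj})\otimes t_{sr},\qquad i,j\in\{1,2\},$$ extends to a coaction $\rho:\mathcal M^{\ell,q}_{\mathbb C}\to G\otimes\mathcal M^{\ell,q}_{\mathbb C}$, i.e. a well-defined algebra homomorphism making $\mathcal M^{\ell,q}_{\mathbb C}$ a left $G$-comodule algebra. Moreover $\rho$ preserves the quantum metric $Q_{\ell/q}=t_{12}t_{21}-q^{-1}\ell\,t_{11}t_{22}$, that is, $\rho(Q_{\ell/q})=1\otimes Q_{\ell/q}$.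
   Context: Parameters: $q,\ell$ are either nonzero complex numbers (ground ring $R=\mathbb C$) or invertible indeterminates (ground ring $R=\mathbb C[q^{\pm1},\ell^{\pm1}]$). All algebras are associative unital $R$-algebras and $\otimes=\otimes_R$. $\mathcal M^{\ell,q}_{\mathbb C}$ is generated by $t_{11},t_{12},t_{21},t_{22}$ with relations $$t_{11}t_{12}=q\ell\,t_{12}t_{11},\quad t_{12}t_{22}=q^{-1}\ell\,t_{22}t_{12},\quad t_{12}t_{21}=t_{21}t_{12}+\ell(q^{-1}-q)t_{11}t_{22},$$ $$t_{11}t_{22}=t_{22}t_{11},\quad t_{11}t_{21}=q^{-1}\ell^{-1}t_{21}t_{11},\quad t_{21}t_{22}=q\ell^{-1}t_{22}t_{21}.$$ $G$ is generated by the entries of $x=(x_{ij})=\begin{pmatrix}a&b\\c&d\end{pmatrix}$ and $y=(y_{ij})=\begin{pmatrix}a'&b'\\c'&d'\end{pmatrix}$ with relations: (i) $ab=q^{-1}ba$, $ac=q^{-1}ca$, $bd=q^{-1}db$, $cd=q^{-1}dc$, $ad-da=(q^{-1}-q)bc$, $bc=cb$, $ad-q^{-1}bc=1$; (ii) the same relations (same $q$) for $a',b',c',d'$; (iii) link relations: $b'a=\ell ab'$, $ac'=\ell c'a$, $a'b=\ell ba'$, $bd'=\ell d'b$, $ca'=\ell a'c$, $d'c=\ell cd'$, $db'=\ell b'd$, $c'd=\ell dc'$, and $aa'=a'a$, $ad'=d'a$, $bb'=b'b$, $bc'=c'b$, $cb'=b'c$, $cc'=c'c$, $da'=a'd$,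 $dd'=d'd$. It is a Hopf algebra with $\Delta(x_{ij})=\sum_k x_{ik}\otimes x_{kj}$, $\Delta(y_{ij})=\sum_k y_{ik}\otimes y_{kj}$, $\epsilon(x_{ij})=\epsilon(y_{ij})=\delta_{ij}$, $S(x)=\begin{pmatrix}d&-qb\\-q^{-1}c&a\end{pmatrix}$, $S(y)=\begin{pmatrix}d'&-qb'\\-q^{-1}c'&a'\end{pmatrix}$ (entrywise, so $S(x_{rj})$ is the $(r,j)$ entry of $S(x)$). *)

(* Defs.v *)
From HB Require Import structures.
From mathcomp Require Import all_boot all_order all_algebra.
From mathcomp Require Import ring.
From mathcomp Require Import boolp reals complex.

Set Implicit Arguments.
Unset Strict Implicit.
Unset Printing Implicit Defensive.

Import GRing.Theory.
Local Open Scope ring_scope.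
Local Open Scope quotient_scope.

(** * Associative unital algebras *)

(* An algebra over [R] is a ring with a ring morphism from [R] to its centre;
   the scalar multiple of [u] by [k] is [k%:S * u].  The [algType] of MathComp
   is not used because it requires [1 != 0], which is not granted for an
   algebra defined by generators and relations. *)
HB.mixin Record isAssocAlgebra (R : comPzRingType) A of GRing.PzRing A := {
  struct_map : R -> A;
  struct_map_zmod : zmod_morphism struct_map;
  struct_map_monoid : monoid_morphism struct_map;
  struct_map_central : forall k u, struct_map k * u = u * struct_map k
}.

#[short(type="algebraType")]
HB.structure Definition AssocAlgebra (R : comPzRingType) :=
  {A of isAssocAlgebra R A & GRing.PzRing A}.

Arguments struct_map {R s} k.
Notation "k %:S" := (struct_map k)
  (at level 2, left associativity, format "k %:S") : ring_scope.

HB.instance Definition _ (R : comPzRingType) (A : algebraType R) :=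
  GRing.isZmodMorphism.Build R A struct_map struct_map_zmod.
HB.instance Definition _ (R : comPzRingType) (A : algebraType R) :=
  GRing.isMonoidMorphism.Build R A struct_map struct_map_monoid.

HB.mixin Record preservesScalars (R : comPzRingType) (A B : algebraType R)
    (f : A -> B) := {
  alghom_scalar : forall k : R, f k%:S = k%:S
}.

HB.structure Definition AlgHom (R : comPzRingType) (A B : algebraType R) :=
  {f of @preservesScalars R A B f & @GRing.RMorphism A B f}.

Notation "{ 'alghom' A -> B }" := (@AlgHom.type _ A%type B%type)
  (at level 0, A at level 98, B at level 99,
   format "{ 'alghom'  A  ->  B }") : type_scope.

HB.instance Definition _ (R : comPzRingType) (A : algebraType R) :=
  preservesScalars.Build R A A idfun (fun k => erefl).

HB.instance Definition _ (R : comPzRingType) :=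
  isAssocAlgebra.Build R R^o (fun x y => erefl) (erefl, fun x y => erefl)
    (@mulrC R).

Section ConverseAlgebra.
Variables (R : comPzRingType) (A : algebraType R).

Lemma converse_monoid : monoid_morphism (struct_map : R -> A^c).
Proof.
have [S1 SM] := @struct_map_monoid R A; split=> [|x y]; first exact: S1.
by rewrite SM struct_map_central.
Qed.

HB.instance Definition _ := isAssocAlgebra.Build R A^c
  (@struct_map_zmod R A) converse_monoid
  (fun k u => esym (@struct_map_central R A k u)).
End ConverseAlgebra.

(** * Algebras given by generators and relations *)

Inductive word (R X : Type) : Type :=
| Gen of X
| WZero
| WOne
| WOpp of word R X
| WAdd of word R X & word R X
| WMul of word R X & word R X
| WScalar of R.

Arguments Gen {R X}.
Arguments WZero {R X}.
Arguments WOne {R X}.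
Arguments WScalar {R X}.

Declare Scope word_scope.
Delimit Scope word_scope with W.
Bind Scope word_scope with word.
Notation "0" := WZero : word_scope.
Notation "1" := WOne : word_scope.
Notation "- u" := (WOpp u) : word_scope.
Notation "u + v" := (WAdd u v) : word_scope.
Notation "u - v" := (WAdd u (WOpp v)) : word_scope.
Notation "u * v" := (WMul u v) : word_scope.
Notation "k *: u" := (WMul (WScalar k%R) u) : word_scope.
Notation "u =~ v" := (u%W, v%W) (at level 70, only parsing) : word_scope.

Section Presentation.
Variables (R : comPzRingType) (X : Type).

HB.instance Definition _ := gen_eqMixin (word R X).
HB.instance Definition _ := gen_choiceMixin (word R X).

Variable rels : seq (word R X * word R X).
Local Open Scope word_scope.

(* The least congruence on words that contains [rels] and whose quotient
   satisfies the axioms of associative unital algebras. *)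
Inductive cong : word R X -> word R X -> Prop :=
| cong_rel u v : List.In (u, v) rels -> cong u v
| cong_refl u : cong u u
| cong_sym u v : cong u v -> cong v u
| cong_trans u v w : cong u v -> cong v w -> cong u w
| cong_opp u u' : cong u u' -> cong (- u) (- u')
| cong_add u u' v v' : cong u u' -> cong v v' -> cong (u + v) (u' + v')
| cong_mul u u' v v' : cong u u' -> cong v v' -> cong (u * v) (u' * v')
| cong_addA u v w : cong (u + (v + w)) (u + v + w)
| cong_addC u v : cong (u + v) (v + u)
| cong_add0 u : cong (0 + u) u
| cong_addN u : cong (- u + u) 0
| cong_mulA u v w : cong (u * (v * w)) (u * v * w)
| cong_mul1l u : cong (1 * u) u
| cong_mul1r u : cong (u * 1) u
| cong_mulDl u v w : cong ((u + v) * w) (u * w + v * w)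
| cong_mulDr u v w : cong (u * (v + w)) (u * v + u * w)
| cong_scalarB k k' :
    cong (WScalar (k - k')%R) (WScalar k - WScalar k')
| cong_scalar1 : cong (WScalar 1%R) 1
| cong_scalarM k k' : cong (WScalar (k * k')%R) (WScalar k * WScalar k')
| cong_scalarC k u : cong (WScalar k * u) (u * WScalar k).

Definition congb (u v : word R X) : bool := `[< cong u v >].

Lemma congb_equiv : equiv_class_of congb.
Proof.
split=> [u|u v|v u w].
- exact/asboolP/cong_refl.
- by apply/asboolP/asboolP; apply: cong_sym.
- by move=> /asboolP uv /asboolP vw; apply/asboolP; apply: cong_trans uv vw.
Qed.

Canonical congb_equivRel := EquivRelPack congb_equiv.
Canonical congb_encModRel := defaultEncModRel congb.

Definition presented : Type := {eq_quot congb}.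
HB.instance Definition _ := Choice.on presented.
HB.instance Definition _ : EqQuotient (word R X) congb presented :=
  EqQuotient.on presented.

Local Notation pi := (\pi_presented).

Lemma piP u v : cong u v -> pi u = pi v.
Proof. by move=> uv; apply/(eqquotP presented)/asboolP. Qed.

Lemma cong_repr u : cong u (repr (pi u)).
Proof. by apply/asboolP/(eqquotP presented); rewrite reprK. Qed.

Definition p_opp := lift_op1 presented (@WOpp R X).
Definition p_add := lift_op2 presented (@WAdd R X).
Definition p_mul := lift_op2 presented (@WMul R X).
Definition p_scalar (k : R) : presented := pi (WScalar k).

Lemma piN u : pi (- u) = p_opp (pi u).
Proof. by unlock p_opp; apply/piP/cong_opp/cong_repr. Qed.
Lemma piD u v : pi (u + v) = p_add (pi u) (pi v).
Proof. by unlock p_add; apply/piP/cong_add; apply: cong_repr. Qed.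
Lemma piM u v : pi (u * v) = p_mul (pi u) (pi v).
Proof. by unlock p_mul; apply/piP/cong_mul; apply: cong_repr. Qed.

Local Ltac by_cong H :=
  repeat (let u := fresh "u" in elim/quotW => u);
  rewrite -!(piN, piD, piM); apply: piP; exact: H.

Lemma p_addA : associative p_add. Proof. by_cong cong_addA. Qed.
Lemma p_addC : commutative p_add. Proof. by_cong cong_addC. Qed.
Lemma p_add0 : left_id (pi 0) p_add. Proof. by_cong cong_add0. Qed.
Lemma p_addN : left_inverse (pi 0) p_opp p_add. Proof. by_cong cong_addN. Qed.

HB.instance Definition _ :=
  GRing.isZmodule.Build presented p_addA p_addC p_add0 p_addN.

Lemma p_mulA : associative p_mul. Proof. by_cong cong_mulA. Qed.
Lemma p_mul1l : left_id (pi 1) p_mul. Proof. by_cong cong_mul1l. Qed.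
Lemma p_mul1r : right_id (pi 1) p_mul. Proof. by_cong cong_mul1r. Qed.
Lemma p_mulDl : left_distributive p_mul p_add. Proof. by_cong cong_mulDl. Qed.
Lemma p_mulDr : right_distributive p_mul p_add. Proof. by_cong cong_mulDr. Qed.

HB.instance Definition _ := GRing.Zmodule_isPzRing.Build presented
  p_mulA p_mul1l p_mul1r p_mulDl p_mulDr.

Lemma p_scalarB : zmod_morphism p_scalar.
Proof.
move=> k k'; rewrite -[RHS]/(p_add _ (p_opp _)) -piN -piD.
exact/piP/cong_scalarB.
Qed.
Lemma p_scalarM : monoid_morphism p_scalar.
Proof.
split=> [|k k']; first exact/piP/cong_scalar1.
by rewrite -[RHS]/(p_mul _ _) -piM; apply/piP/cong_scalarM.
Qed.
Lemma p_scalarC k (u : presented) :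
  (p_scalar k * u = u * p_scalar k)%R.
Proof. by move: u; rewrite /GRing.mul /=; by_cong cong_scalarC. Qed.

HB.instance Definition _ := isAssocAlgebra.Build R presented
  p_scalarB p_scalarM p_scalarC.

Definition gen (x : X) : presented := pi (Gen x).

End Presentation.

Section Lift.
Variables (R : comPzRingType) (X : Type) (A : algebraType R) (f : X -> A).

Fixpoint weval (u : word R X) : A :=
  match u with
  | Gen x => f x
  | WZero => 0
  | WOne => 1
  | WOpp v => - weval v
  | WAdd v w => weval v + weval w
  | WMul v w => weval v * weval w
  | WScalar k => k%:S
  end.

Fixpoint satisfies (rels : seq (word R X * word R X)) : Prop :=
  if rels is (u, v) :: rels' then weval u = weval v /\ satisfies rels'
  else True.

Variable rels : seq (word R X * word R X).
Hypothesis fP : satisfies rels.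

Definition lift of satisfies rels := fun u : presented rels => weval (repr u).

Lemma weval_cong u v : cong rels u v -> weval u = weval v.
Proof.
elim=> {u v} //=.
- move=> u v; elim: rels fP => //= -[u' v'] s IHs [uv /IHs {}IHs] [|//].
  by case=> <- <-.
- by move=> u v w _ -> _ ->.
- by move=> u u' _ ->.
- by move=> u u' v v' _ -> _ ->.
- by move=> u u' v v' _ -> _ ->.
- by move=> u v w; rewrite addrA.
- by move=> u v; rewrite addrC.
- by move=> u; rewrite add0r.
- by move=> u; rewrite addNr.
- by move=> u v w; rewrite mulrA.
- by move=> u; rewrite mul1r.
- by move=> u; rewrite mulr1.
- by move=> u v w; rewrite mulrDl.
- by move=> u v w; rewrite mulrDr.
- by move=> k k'; rewrite rmorphB.
- by rewrite rmorph1.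
- by move=> k k'; rewrite rmorphM.
- by move=> k u; rewrite struct_map_central.
Qed.

Lemma liftE u : lift fP (\pi u) = weval u.
Proof. by apply/weval_cong/cong_sym/cong_repr. Qed.

Lemma lift_gen x : lift fP (gen rels x) = f x.
Proof. exact: liftE. Qed.

Lemma lift_zmod_morphism : zmod_morphism (lift fP).
Proof.
elim/quotW=> u; elim/quotW=> v; rewrite -[_ - _]/(p_add _ (p_opp _)).
by rewrite -piN -piD !liftE.
Qed.
Lemma lift_monoid_morphism : monoid_morphism (lift fP).
Proof.
split; first exact: (liftE WOne).
elim/quotW=> u; elim/quotW=> v; rewrite -[_ * _]/(p_mul _ _).
by rewrite -piM !liftE.
Qed.
Lemma lift_scalar k : lift fP k%:S = k%:S.
Proof. exact: (liftE (WScalar k)). Qed.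

HB.instance Definition _ := GRing.isZmodMorphism.Build
  (presented rels) A (lift fP) lift_zmod_morphism.
HB.instance Definition _ := GRing.isMonoidMorphism.Build
  (presented rels) A (lift fP) lift_monoid_morphism.
HB.instance Definition _ := preservesScalars.Build
  R (presented rels) A (lift fP) lift_scalar.

End Lift.

Section PresentedTheory.
Variables (R : comPzRingType) (X : Type) (rels : seq (word R X * word R X)).

Lemma weval_gen (u : word R X) : weval (gen rels) u = \pi u.
Proof.
elim: u => //= [u ->|u -> v ->|u -> v ->].
- by rewrite piN.
- by rewrite piD.
- by rewrite piM.
Qed.

Lemma gen_rel u v : List.In (u, v) rels ->
  weval (gen rels) u = weval (gen rels) v.
Proof. by move=> uv; rewrite !weval_gen; apply/piP/cong_rel. Qed.

Lemma gen_satisfies : satisfies (gen rels) rels.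
Proof.
suff: forall s, List.incl s rels -> satisfies (gen rels) s.
  by apply; exact: List.incl_refl.
elim=> //= -[u v] s IHs su; split.
  by apply: gen_rel; apply: su; left.
by apply: IHs => uv uvs; apply: su; right.
Qed.

End PresentedTheory.

(** * Tensor products over the ground ring *)

Inductive tword (A B : Type) : Type :=
| TPure of A & B
| TZero
| TOpp of tword A B
| TAdd of tword A B & tword A B.

Arguments TZero {A B}.

Section Tensor.
Variables (R : comPzRingType) (A B : algebraType R).

HB.instance Definition _ := gen_eqMixin (tword A B).
HB.instance Definition _ := gen_choiceMixin (tword A B).

Inductive tcong : tword A B -> tword A B -> Prop :=
| tcong_refl u : tcong u u
| tcong_sym u v : tcong u v -> tcong v u
| tcong_trans u v w : tcong u v -> tcong v w -> tcong u w
| tcong_opp u u' : tcong u u' -> tcong (TOpp u) (TOpp u')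
| tcong_add u u' v v' : tcong u u' -> tcong v v' ->
    tcong (TAdd u v) (TAdd u' v')
| tcong_addA u v w : tcong (TAdd u (TAdd v w)) (TAdd (TAdd u v) w)
| tcong_addC u v : tcong (TAdd u v) (TAdd v u)
| tcong_add0 u : tcong (TAdd TZero u) u
| tcong_addN u : tcong (TAdd (TOpp u) u) TZero
| tcong_pureDl a a' b : tcong (TPure (a + a') b) (TAdd (TPure a b) (TPure a' b))
| tcong_pureDr a b b' : tcong (TPure a (b + b')) (TAdd (TPure a b) (TPure a b'))
| tcong_balanced k a b : tcong (TPure (k%:S * a) b) (TPure a (k%:S * b)).

Definition tcongb (u v : tword A B) : bool := `[< tcong u v >].

Lemma tcongb_equiv : equiv_class_of tcongb.
Proof.
split=> [u|u v|v u w].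
- exact/asboolP/tcong_refl.
- by apply/asboolP/asboolP; apply: tcong_sym.
- by move=> /asboolP uv /asboolP vw; apply/asboolP; apply: tcong_trans uv vw.
Qed.

Canonical tcongb_equivRel := EquivRelPack tcongb_equiv.
Canonical tcongb_encModRel := defaultEncModRel tcongb.

Definition tens : Type := {eq_quot tcongb}.
HB.instance Definition _ := Choice.on tens.
HB.instance Definition _ : EqQuotient (tword A B) tcongb tens :=
  EqQuotient.on tens.

Local Notation pi := (\pi_tens).

Lemma tpiP u v : tcong u v -> pi u = pi v.
Proof. by move=> uv; apply/(eqquotP tens)/asboolP. Qed.

Lemma tcong_repr u : tcong u (repr (pi u)).
Proof. by apply/asboolP/(eqquotP tens); rewrite reprK. Qed.

Definition t_opp := lift_op1 tens (@TOpp A B).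
Definition t_add := lift_op2 tens (@TAdd A B).

Lemma tpiN u : pi (TOpp u) = t_opp (pi u).
Proof. by unlock t_opp; apply/tpiP/tcong_opp/tcong_repr. Qed.
Lemma tpiD u v : pi (TAdd u v) = t_add (pi u) (pi v).
Proof. by unlock t_add; apply/tpiP/tcong_add; apply: tcong_repr. Qed.

Local Ltac by_tcong H :=
  repeat (let u := fresh "u" in elim/quotW => u);
  rewrite -!(tpiN, tpiD); apply: tpiP; exact: H.

Lemma t_addA : associative t_add. Proof. by_tcong tcong_addA. Qed.
Lemma t_addC : commutative t_add. Proof. by_tcong tcong_addC. Qed.
Lemma t_add0 : left_id (pi TZero) t_add. Proof. by_tcong tcong_add0. Qed.
Lemma t_addN : left_inverse (pi TZero) t_opp t_add.
Proof. by_tcong tcong_addN. Qed.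

HB.instance Definition _ :=
  GRing.isZmodule.Build tens t_addA t_addC t_add0 t_addN.

Definition pure (a : A) (b : B) : tens := pi (TPure a b).

Lemma pureDl b : {morph pure^~ b : a a' / a + a'}.
Proof. by move=> a a'; rewrite -[RHS]tpiD; apply/tpiP/tcong_pureDl. Qed.
Lemma pureDr a : {morph pure a : b b' / b + b'}.
Proof. by move=> b b'; rewrite -[RHS]tpiD; apply/tpiP/tcong_pureDr. Qed.
Lemma pureSl k a b : pure (k%:S * a) b = pure a (k%:S * b).
Proof. exact/tpiP/tcong_balanced. Qed.

Lemma tens_ind (P : tens -> Prop) :
  (forall a b, P (pure a b)) -> (forall u v, P u -> P v -> P (u - v)) ->
  forall u, P u.
Proof.
move=> Ppure PB; have P0: P 0.
  by rewrite -(subrr (pure 0 0)); apply: PB.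
elim/quotW; elim=> [a b||u Pu|u Pu v Pv]; first exact: Ppure.
- exact: P0.
- by rewrite tpiN -[t_opp _]sub0r; apply: PB.
have PD x y : P x -> P y -> P (x + y).
  move=> Px Py; rewrite -[y]opprK; apply: (PB) => //.
  by rewrite -sub0r; apply: PB.
by rewrite tpiD; apply: PD.
Qed.

End Tensor.

Arguments tens {R} (A B)%_type_scope.
Notation "A \ox B" := (tens A B) (at level 40, left associativity) : type_scope.
Notation "a \ox b" := (pure a b) (at level 40, left associativity) : ring_scope.

Section TensorLift.
Variables (R : comPzRingType) (A B : algebraType R) (V : zmodType).

Definition balanced (f : A -> B -> V) : Prop :=
  [/\ forall b, {morph f^~ b : a a' / a + a'},
      forall a, {morph f a : b b' / b + b'}
    & forall (k : R) a b, f (k%:S * a) b = f a (k%:S * b)].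

Fixpoint teval (f : A -> B -> V) (u : tword A B) : V :=
  match u with
  | TPure a b => f a b
  | TZero => 0
  | TOpp v => - teval f v
  | TAdd v w => teval f v + teval f w
  end.

Definition tlift (f : A -> B -> V) of balanced f :=
  fun u : A \ox B => teval f (repr u).

Variables (f : A -> B -> V) (fP : balanced f).

Lemma teval_cong u v : tcong u v -> teval f u = teval f v.
Proof.
have [fl fr fS] := fP; elim=> {u v} //=.
- by move=> u v w _ -> _ ->.
- by move=> u u' _ ->.
- by move=> u u' v v' _ -> _ ->.
- by move=> u v w; rewrite addrA.
- by move=> u v; rewrite addrC.
- by move=> u; rewrite add0r.
- by move=> u; rewrite addNr.
- by move=> a a' b; apply: fl.
Qed.

Lemma tliftE u : tlift fP (\pi u) = teval f u.
Proof. by apply/teval_cong/tcong_sym/tcong_repr. Qed.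

Lemma tlift_pure a b : tlift fP (a \ox b) = f a b.
Proof. exact: tliftE. Qed.

Lemma tlift_zmod_morphism : zmod_morphism (tlift fP).
Proof.
elim/quotW=> u; elim/quotW=> v; rewrite -[_ - _]/(t_add _ (t_opp _)).
by rewrite -tpiN -tpiD !tliftE.
Qed.

HB.instance Definition _ := GRing.isZmodMorphism.Build
  (A \ox B)%type V (tlift fP) tlift_zmod_morphism.

Lemma tliftB u v : tlift fP (u - v) = tlift fP u - tlift fP v.
Proof. exact: raddfB. Qed.

End TensorLift.

Section TensorAlgebra.
Variables (R : comPzRingType) (A B : algebraType R).

Lemma pure_mul_balanced a b :
  balanced (fun a' b' => (a * a') \ox (b * b') : A \ox B).
Proof.
split=> [b' x y|a' x y|k a' b'] /=.
- by rewrite mulrDr pureDl.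
- by rewrite mulrDr pureDr.
- by rewrite !mulrA -!struct_map_central -!mulrA pureSl.
Qed.

Lemma mul_balanced (v : A \ox B) :
  balanced (fun a b => tlift (pure_mul_balanced a b) v).
Proof.
split=> [b x y|a x y|k a b] /=; elim/tens_ind: v => [a' b'|v w IHv IHw].
- by rewrite !tlift_pure mulrDl pureDl.
- by rewrite !tliftB IHv IHw opprD addrACA.
- by rewrite !tlift_pure mulrDl pureDr.
- by rewrite !tliftB IHv IHw opprD addrACA.
- by rewrite !tlift_pure -!mulrA pureSl.
- by rewrite !tliftB IHv IHw.
Qed.

Definition t_mul (u v : A \ox B) : A \ox B := tlift (mul_balanced v) u.

Lemma t_mul_pure a b a' b' :
  t_mul (a \ox b) (a' \ox b') = (a * a') \ox (b * b').
Proof. by rewrite /t_mul !tlift_pure. Qed.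

Lemma t_mulBl u v w : t_mul (u - v) w = t_mul u w - t_mul v w.
Proof. exact: raddfB. Qed.

Lemma t_mulBr w u v : t_mul w (u - v) = t_mul w u - t_mul w v.
Proof.
elim/tens_ind: w => [a b|w w' IHw IHw'].
  by rewrite /t_mul !tlift_pure tliftB.
by rewrite !t_mulBl IHw IHw' !opprB addrACA [RHS]addrACA [- _ + _]addrC.
Qed.

Lemma t_mulA : associative t_mul.
Proof.
elim/tens_ind=> [a b|u u' IHu IHu' v w]; last first.
  by rewrite !t_mulBl IHu IHu'.
elim/tens_ind=> [a' b'|v v' IHv IHv' w]; last first.
  by rewrite t_mulBl !t_mulBr t_mulBl IHv IHv'.
elim/tens_ind=> [a'' b''|w w' IHw IHw']; last by rewrite !t_mulBr IHw IHw'.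
by rewrite !t_mul_pure !mulrA.
Qed.

Lemma t_mul1l : left_id (1 \ox 1) t_mul.
Proof.
elim/tens_ind=> [a b|u v IHu IHv]; first by rewrite t_mul_pure !mul1r.
by rewrite t_mulBr IHu IHv.
Qed.

Lemma t_mul1r : right_id (1 \ox 1) t_mul.
Proof.
elim/tens_ind=> [a b|u v IHu IHv]; first by rewrite t_mul_pure !mulr1.
by rewrite t_mulBl IHu IHv.
Qed.

Lemma t_mulDl : left_distributive t_mul +%R.
Proof. by move=> u v w; apply: raddfD. Qed.

Lemma t_mulDr : right_distributive t_mul +%R.
Proof.
move=> w u v; have t_mulN x : t_mul w (- x) = - t_mul w x.
  by rewrite -sub0r t_mulBr -(subrr x) t_mulBr subrr sub0r.
by rewrite -{1}[v]opprK t_mulBr t_mulN opprK.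
Qed.

HB.instance Definition _ := GRing.Zmodule_isPzRing.Build (A \ox B)%type
  t_mulA t_mul1l t_mul1r t_mulDl t_mulDr.

Lemma pureM (a a' : A) (b b' : B) :
  (a \ox b) * (a' \ox b') = (a * a') \ox (b * b').
Proof. exact: t_mul_pure. Qed.

Lemma pure1 : 1 \ox 1 = 1 :> A \ox B. Proof. by []. Qed.

Definition t_scalar : R -> A \ox B := locked (fun k => k%:S \ox 1).

Lemma t_scalarE k : t_scalar k = k%:S \ox 1.
Proof. by rewrite /t_scalar -lock. Qed.

Lemma t_scalarB : zmod_morphism t_scalar.
Proof.
move=> k k'; rewrite !t_scalarE rmorphB; apply: (addIr (k'%:S \ox 1)).
by rewrite subrK -pureDl subrK.
Qed.
Lemma t_scalarM : monoid_morphism t_scalar.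
Proof.
by split=> [|k k']; rewrite !t_scalarE ?rmorph1 // pureM mulr1 rmorphM.
Qed.
Lemma t_scalarC k u : t_scalar k * u = u * t_scalar k.
Proof.
elim/tens_ind: u => [a b|u v IHu IHv]; last by rewrite mulrBr mulrBl IHu IHv.
by rewrite t_scalarE !pureM struct_map_central mul1r mulr1.
Qed.

HB.instance Definition _ := isAssocAlgebra.Build R (A \ox B)%type
  t_scalarB t_scalarM t_scalarC.

Lemma scale_purel k (a : A) (b : B) : k%:S * (a \ox b) = (k%:S * a) \ox b.
Proof. by rewrite -[k%:S]/(t_scalar k) t_scalarE pureM mul1r. Qed.
Lemma scale_purer k (a : A) (b : B) : k%:S * (a \ox b) = a \ox (k%:S * b).
Proof. by rewrite scale_purel pureSl. Qed.

End TensorAlgebra.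

(* [tens_map f g] is [f (x) g], [tens_assoc] the canonical isomorphism
   [(A (x) B) (x) C -> A (x) (B (x) C)] and [tens_unitl] the canonical
   isomorphism [R (x) A -> A]. *)
Section TensorMaps.
Variable R : comPzRingType.

Lemma tens_map_balanced (A B A' B' : algebraType R)
    (f : {alghom A -> A'}) (g : {alghom B -> B'}) :
  balanced (fun a b => f a \ox g b).
Proof.
split=> [b x y|a x y|k a b]; first by rewrite rmorphD pureDl.
- by rewrite rmorphD pureDr.
- by rewrite !rmorphM /= !alghom_scalar pureSl.
Qed.
Definition tens_map (A B A' B' : algebraType R)
    (f : {alghom A -> A'}) (g : {alghom B -> B'}) : A \ox B -> A' \ox B' :=
  tlift (tens_map_balanced f g).

Lemma assoc1_balanced (A B C : algebraType R) (c : C) :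
  balanced (fun (a : A) (b : B) => a \ox (b \ox c)).
Proof.
split=> [b x y|a x y|k a b]; first exact: pureDl.
- by rewrite pureDl pureDr.
- by rewrite pureSl scale_purel.
Qed.
Lemma assoc_balanced (A B C : algebraType R) :
  balanced (fun (u : A \ox B) (c : C) => tlift (assoc1_balanced A B c) u).
Proof.
split=> [c x y|u x y|k u c]; first exact: raddfD.
- elim/tens_ind: u => [a b|u v IHu IHv]; first by rewrite !tlift_pure !pureDr.
  by rewrite !tliftB IHu IHv opprD addrACA.
- elim/tens_ind: u => [a b|u v IHu IHv].
    by rewrite scale_purel !tlift_pure -!scale_purer -scale_purel.
  by rewrite mulrBr !tliftB IHu IHv.
Qed.
Definition tens_assoc (A B C : algebraType R) :
  (A \ox B) \ox C -> A \ox (B \ox C) := tlift (assoc_balanced A B C).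

Lemma unitl_balanced (A : algebraType R) :
  balanced (fun (k : R^o) (a : A) => (k : R)%:S * a).
Proof.
split=> [a x y|k x y|k x a]; first by rewrite rmorphD mulrDl.
- by rewrite mulrDr.
- by rewrite [_ * x]mulrC rmorphM mulrA.
Qed.
Definition tens_unitl (A : algebraType R) : R^o \ox A -> A :=
  tlift (unitl_balanced A).

End TensorMaps.

(** * Linear combinations in an algebra *)

(* A reflexive procedure for identities between linear combinations, used to
   check that defining relations are preserved. *)
Inductive lincomb (R : Type) : Type :=
| LVar of nat
| LZero
| LOpp of lincomb R
| LAdd of lincomb R & lincomb R
| LScale of R & lincomb R.

Arguments LZero {R}.
Arguments LVar {R} n.

Section LinComb.
Variables (R : comPzRingType) (A : algebraType R).

Fixpoint leval (env : seq A) (e : lincomb R) : A :=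
  match e with
  | LVar n => nth 0 env n
  | LZero => 0
  | LOpp e1 => - leval env e1
  | LAdd e1 e2 => leval env e1 + leval env e2
  | LScale k e1 => k%:S * leval env e1
  end.

Fixpoint lcoef (e : lincomb R) (n : nat) : R :=
  match e with
  | LVar m => if m == n then 1 else 0
  | LZero => 0
  | LOpp e1 => - lcoef e1 n
  | LAdd e1 e2 => lcoef e1 n + lcoef e2 n
  | LScale k e1 => k * lcoef e1 n
  end.

Fixpoint lcoefs_eq (n : nat) (e1 e2 : lincomb R) : Prop :=
  if n is n'.+1 then lcoef e1 n' = lcoef e2 n' /\ lcoefs_eq n' e1 e2 else True.

Lemma levalE env e :
  leval env e = \sum_(i < size env) (lcoef e i)%:S * nth 0 env i.
Proof.
elim: e => [n||e IHe|e1 IH1 e2 IH2|k e IHe] /=.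
- have [ltn|len] := ltnP n (size env).
    rewrite (bigD1 (Ordinal ltn)) //= eqxx rmorph1 mul1r big1 ?addr0 // => i ni.
    case: eqP => [E|_]; last by rewrite rmorph0 mul0r.
    by case/eqP: ni; apply: val_inj.
  rewrite nth_default // big1 // => i _; case: eqP => [E|_].
    by move: (ltn_ord i); rewrite -E ltnNge len.
  by rewrite rmorph0 mul0r.
- by rewrite big1 // => i _; rewrite rmorph0 mul0r.
- by rewrite IHe -sumrN; apply: eq_bigr => i _; rewrite rmorphN mulNr.
- rewrite IH1 IH2 -big_split; apply: eq_bigr => i _ /=.
  by rewrite rmorphD mulrDl.
- by rewrite IHe mulr_sumr; apply: eq_bigr => i _; rewrite rmorphM mulrA.
Qed.

Lemma lcoefs_eqP n e1 e2 i :
  lcoefs_eq n e1 e2 -> (i < n)%N -> lcoef e1 i = lcoef e2 i.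
Proof.
elim: n => //= n IHn [En /IHn {}IHn]; rewrite ltnS leq_eqVlt.
by case: eqP => [->|].
Qed.

Lemma leval_eq env e1 e2 :
  lcoefs_eq (size env) e1 e2 -> leval env e1 = leval env e2.
Proof.
move=> E; rewrite !levalE; apply: eq_bigr => i _.
by rewrite (lcoefs_eqP E).
Qed.

Lemma mul_scalarl (k : R) (u v : A) : k%:S * u * v = k%:S * (u * v).
Proof. by rewrite mulrA. Qed.
Lemma mul_scalarr (k : R) (u v : A) : u * (k%:S * v) = k%:S * (u * v).
Proof. by rewrite mulrA -struct_map_central mulrA. Qed.

End LinComb.

Ltac lc_index x l :=
  match l with
  | ?x' :: _ => let _ := match constr:(tt) with _ => unify x x' end in
                constr:(0%N)
  | _ :: ?l' => let n := lc_index x l' in constr:(n.+1)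
  end.
Ltac lc_atoms t l :=
  match t with
  | (?u + ?v)%R => let l1 := lc_atoms u l in lc_atoms v l1
  | (- ?u)%R => lc_atoms u l
  | (struct_map _ * ?u)%R => lc_atoms u l
  | 0%R => l
  | _ => match l with
         | _ => let n := lc_index t l in l
         | _ => constr:(t :: l)
         end
  end.
Ltac lc_reify R t l :=
  match t with
  | (?u + ?v)%R =>
      let e1 := lc_reify R u l in let e2 := lc_reify R v l in
      constr:(@LAdd R e1 e2)
  | (- ?u)%R => let e := lc_reify R u l in constr:(@LOpp R e)
  | (struct_map ?k * ?u)%R =>
      let e := lc_reify R u l in constr:(@LScale R k e)
  | 0%R => constr:(@LZero R)
  | _ => let n := lc_index t l in constr:(@LVar R n)
  end.
(* Reduces an equality in an algebra over [R] to the equalities in [R] of the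
   coefficients. *)
Ltac lincomb R :=
  lazymatch goal with
  | |- ?t1 = ?t2 =>
    let T := type of t1 in
    let l0 := lc_atoms t1 (@nil T) in
    let l := lc_atoms t2 l0 in
    let e1 := lc_reify (GRing.ComPzRing.sort R) t1 l in
    let e2 := lc_reify (GRing.ComPzRing.sort R) t2 l in
    apply: (@leval_eq R _ l e1 e2); rewrite /lcoefs_eq /lcoef /=; do ?split
  end.

(** * The quantum Minkowski space and the quantum Lorentz group *)

Notation i1 := (@ord0 1).
Notation i2 := (@ord_max 1).

Section Definitions.
Variables (R : comUnitRingType) (q l : R).

Definition mink_rels : seq (word R ('I_2 * 'I_2) * word R ('I_2 * 'I_2)) :=
  let t11 := Gen (i1, i1) in let t12 := Gen (i1, i2) in
  let t21 := Gen (i2, i1) in let t22 := Gen (i2, i2) in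
  [:: t11 * t12 =~ (q * l) *: (t12 * t11);
      t12 * t22 =~ (q^-1 * l) *: (t22 * t12);
      t12 * t21 =~ t21 * t12 + (l * (q^-1 - q)) *: (t11 * t22);
      t11 * t22 =~ t22 * t11;
      t11 * t21 =~ (q^-1 * l^-1) *: (t21 * t11);
      t21 * t22 =~ (q * l^-1) *: (t22 * t21)]%W.

Definition Mink : Type := presented mink_rels.
HB.instance Definition _ := AssocAlgebra.on Mink.

Definition tgen (i j : 'I_2) : Mink := gen mink_rels (i, j).

(* The quantum metric with parameter [l / q]. *)
Definition Qmetric : Mink :=
  tgen i1 i2 * tgen i2 i1 - (q^-1 * l)%:S * (tgen i1 i1 * tgen i2 i2).

Inductive lorentz_gen : Type := GX of 'I_2 & 'I_2 | GY of 'I_2 & 'I_2.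

Definition slq_rels (X : Type) (a b c d : word R X) :
    seq (word R X * word R X) :=
  [:: a * b =~ q^-1 *: (b * a);
      a * c =~ q^-1 *: (c * a);
      b * d =~ q^-1 *: (d * b);
      c * d =~ q^-1 *: (d * c);
      a * d - d * a =~ (q^-1 - q) *: (b * c);
      b * c =~ c * b;
      a * d - q^-1 *: (b * c) =~ 1]%W.

Definition link_rels (X : Type) (a b c d a' b' c' d' : word R X) :
    seq (word R X * word R X) :=
  [:: b' * a =~ l *: (a * b'); a * c' =~ l *: (c' * a);
      a' * b =~ l *: (b * a'); b * d' =~ l *: (d' * b);
      c * a' =~ l *: (a' * c); d' * c =~ l *: (c * d');
      d * b' =~ l *: (b' * d); c' * d =~ l *: (d * c');
      a * a' =~ a' * a; a * d' =~ d' * a;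
      b * b' =~ b' * b; b * c' =~ c' * b;
      c * b' =~ b' * c; c * c' =~ c' * c;
      d * a' =~ a' * d; d * d' =~ d' * d]%W.

Definition lorentz_rels : seq (word R lorentz_gen * word R lorentz_gen) :=
  let a := Gen (GX i1 i1) in let b := Gen (GX i1 i2) in
  let c := Gen (GX i2 i1) in let d := Gen (GX i2 i2) in
  let a' := Gen (GY i1 i1) in let b' := Gen (GY i1 i2) in
  let c' := Gen (GY i2 i1) in let d' := Gen (GY i2 i2) in
  slq_rels a b c d ++ slq_rels a' b' c' d' ++ link_rels a b c d a' b' c' d'.

Definition Lorentz : Type := presented lorentz_rels.
HB.instance Definition _ := AssocAlgebra.on Lorentz.

Definition xgen (i j : 'I_2) : Lorentz := gen lorentz_rels (GX i j).
Definition ygen (i j : 'I_2) : Lorentz := gen lorentz_rels (GY i j).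

(** ** The Hopf structure of the quantum Lorentz group *)

Definition comul_gen (g : lorentz_gen) : Lorentz \ox Lorentz :=
  match g with
  | GX i j => \sum_k xgen i k \ox xgen k j
  | GY i j => \sum_k ygen i k \ox ygen k j
  end.

Definition counit_gen (g : lorentz_gen) : R^o :=
  match g with GX i j | GY i j => (i == j)%:R end.

(* The matrix (d, - q b; - q^-1 c, a) for z = (a, b; c, d). *)
Definition antipode_mx (z : 'I_2 -> 'I_2 -> Lorentz) (i j : 'I_2) : Lorentz :=
  if i == i1 then (if j == i1 then z i2 i2 else - (q%:S * z i1 i2))
  else (if j == i1 then - (q^-1%:S * z i2 i1) else z i1 i1).

Definition antipode_gen (g : lorentz_gen) : Lorentz^c :=
  match g with
  | GX i j => antipode_mx xgen i j
  | GY i j => antipode_mx ygen i j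
  end.

Definition slqP (A : algebraType R) (a b c d : A) : Prop :=
  [/\ a * b = q^-1%:S * (b * a), a * c = q^-1%:S * (c * a),
      b * d = q^-1%:S * (d * b), c * d = q^-1%:S * (d * c)
   & [/\ a * d - d * a = (q^-1 - q)%:S * (b * c), b * c = c * b
      & a * d - q^-1%:S * (b * c) = 1]].

Lemma counit_satisfies : satisfies counit_gen lorentz_rels.
Proof.
have S1 (k : R) : k%:S = k :> R^o by [].
by do ![split]; rewrite /= ?S1 ?(mulr0, mul0r, mulr1, subr0, subrr).
Qed.

Hypotheses (qU : q \is a GRing.unit) (lU : l \is a GRing.unit).

Let qK : q * q^-1 = 1. Proof. exact: divrr. Qed.
Let lK : l * l^-1 = 1. Proof. exact: divrr. Qed.

Lemma scalar_flip (A : algebraType R) (k : R) (u v : A) :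
  k \is a GRing.unit -> u = k%:S * v -> v = k^-1%:S * u.
Proof. by move=> kU ->; rewrite mulrA -rmorphM mulVr // rmorph1 mul1r. Qed.

(* Normal forms modulo the relations. *)
Lemma slq_nf (A : algebraType R) (a b c d : A) : slqP a b c d ->
  [/\ b * a = q%:S * (a * b), c * a = q%:S * (a * c),
      d * b = q%:S * (b * d), d * c = q%:S * (c * d)
   & [/\ c * b = b * c, a * d = 1 + q^-1%:S * (b * c)
      & d * a = 1 + q%:S * (b * c)]].
Proof.
case=> ab ac bd cd [ad bc det].
have qVU : q^-1 \is a GRing.unit by rewrite unitrV.
have adE : a * d = 1 + q^-1%:S * (b * c) by rewrite -det subrK.
split; first by rewrite (scalar_flip qVU ab) invrK.
- by rewrite (scalar_flip qVU ac) invrK.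
- by rewrite (scalar_flip qVU bd) invrK.
- by rewrite (scalar_flip qVU cd) invrK.
split=> //; rewrite -[LHS](subKr (a * d)) ad adE.
by lincomb R; ring.
Qed.

Lemma slq_comul (A : algebraType R) (a b c d : A) : slqP a b c d ->
  slqP (a \ox a + b \ox c) (a \ox b + b \ox d)
       (c \ox a + d \ox c) (c \ox b + d \ox d).
Proof.
move=> /slq_nf[ba ca db dc [cb ad da]].
have nf := (ba, ca, db, dc, cb, ad, da).
split; last split.
all: rewrite -?pure1 !(mulrDl, mulrDr) !pureM !nf ?(pureDl, pureDr)
       -?(scale_purel, scale_purer); lincomb R.
all: by ring: qK.
Qed.

Section ConverseProducts.
Variable A : algebraType R.
Implicit Types u v w z : A.

Lemma converseE u v w z : v * u = z * w -> (u : A^c) * v = (w : A^c) * z.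
Proof. by []. Qed.
Lemma converseS (k : R) u v w z :
  v * u = k%:S * (z * w) -> (u : A^c) * v = k%:S * ((w : A^c) * z).
Proof. by move=> E; rewrite struct_map_central; exact: E. Qed.
Lemma converseB (k : R) u v w z u' v' :
  v * u - v' * u' = k%:S * (z * w) ->
  (u : A^c) * v - (u' : A^c) * v' = k%:S * ((w : A^c) * z).
Proof. by move=> E; rewrite struct_map_central; exact: E. Qed.
Lemma converse1 (k : R) u v w z :
  v * u - k%:S * (z * w) = 1 ->
  (u : A^c) * v - k%:S * ((w : A^c) * z) = 1.
Proof. by move=> E; rewrite struct_map_central; exact: E. Qed.
End ConverseProducts.

Lemma slq_antipode (A : algebraType R) (a b c d : A) : slqP a b c d ->
  @slqP A^c d (- (q%:S * b)) (- (q^-1%:S * c)) a.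
Proof.
move=> /slq_nf[ba ca db dc [cb ad da]].
have ms (u : A) k v : u * (k%:S * v) = k%:S * (u * v) := mul_scalarr k u v.
have nf := (ba, ca, db, dc, cb, ad, da, @mul_scalarl R A,
  ms a, ms b, ms c, ms d).
split; last split.
1-4: apply: converseS.
5: apply: converseB.
6: apply: converseE.
7: apply: converse1.
all: rewrite !(mulrN, mulNr, opprK) !nf; lincomb R.
all: by ring: qK.
Qed.

Lemma satisfies_cat (X : Type) (A : algebraType R) (f : X -> A) r1 r2 :
  satisfies f r1 -> satisfies f r2 -> satisfies f (r1 ++ r2).
Proof. by elim: r1 => //= -[u v] r1 IH [uv r1P] r2P; split=> //; apply: IH. Qed.

Lemma slq_satisfies (X : Type) (A : algebraType R) (f : X -> A) a b c d :
  slqP (weval f a) (weval f b) (weval f c) (weval f d) ->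
  satisfies f (slq_rels a b c d).
Proof. by case=> ? ? ? ? [? ? ?]; do ![split]. Qed.

Lemma x_slq : slqP (xgen i1 i1) (xgen i1 i2) (xgen i2 i1) (xgen i2 i2).
Proof.
have /= := gen_satisfies lorentz_rels.
by do 7![case=> ?]; move=> _; do ![split].
Qed.

Lemma y_slq : slqP (ygen i1 i1) (ygen i1 i2) (ygen i2 i1) (ygen i2 i2).
Proof.
have /= := gen_satisfies lorentz_rels.
by do 7![case=> _]; do 7![case=> ?]; move=> _; do ![split].
Qed.

Lemma sum2 (V : zmodType) (F : 'I_2 -> V) : \sum_k F k = F i1 + F i2.
Proof.
rewrite big_ord_recl big_ord_recl big_ord0 addr0; congr (_ + F _).
exact: val_inj.
Qed.

Definition linkP (A : algebraType R) (a b c d a' b' c' d' : A) : Prop :=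
  [/\ [/\ b' * a = l%:S * (a * b'), a * c' = l%:S * (c' * a),
          a' * b = l%:S * (b * a') & b * d' = l%:S * (d' * b)],
      [/\ c * a' = l%:S * (a' * c), d' * c = l%:S * (c * d'),
          d * b' = l%:S * (b' * d) & c' * d = l%:S * (d * c')],
      [/\ a * a' = a' * a, a * d' = d' * a, b * b' = b' * b & b * c' = c' * b]
   & [/\ c * b' = b' * c, c * c' = c' * c, d * a' = a' * d & d * d' = d' * d]].

Lemma link_satisfies (X : Type) (A : algebraType R) (f : X -> A)
    a b c d a' b' c' d' :
  linkP (weval f a) (weval f b) (weval f c) (weval f d)
        (weval f a') (weval f b') (weval f c') (weval f d') ->
  satisfies f (link_rels a b c d a' b' c' d').
Proof.
by case=> -[? ? ? ?] [? ? ? ?] [? ? ? ?] [? ? ? ?]; do ![split].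
Qed.

Lemma xy_link : linkP (xgen i1 i1) (xgen i1 i2) (xgen i2 i1) (xgen i2 i2)
                      (ygen i1 i1) (ygen i1 i2) (ygen i2 i1) (ygen i2 i2).
Proof.
have /= := gen_satisfies lorentz_rels.
by do 14![case=> _]; do 16![case=> ?]; move=> _; do ![split].
Qed.

Lemma link_comul (A : algebraType R) (a b c d a' b' c' d' : A) :
  linkP a b c d a' b' c' d' ->
  linkP (a \ox a + b \ox c) (a \ox b + b \ox d)
        (c \ox a + d \ox c) (c \ox b + d \ox d)
        (a' \ox a' + b' \ox c') (a' \ox b' + b' \ox d')
        (c' \ox a' + d' \ox c') (c' \ox b' + d' \ox d').
Proof.
case=> -[b'a ac' a'b bd'] [ca' d'c db' c'd] [aa' ad' bb' bc'] [cb' cc' da' dd'].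
have c'a := scalar_flip lU ac'; have d'b := scalar_flip lU bd'.
have a'c := scalar_flip lU ca'; have b'd := scalar_flip lU db'.
have nf := (b'a, c'a, a'b, d'b, a'c, d'c, b'd, c'd,
  esym aa', esym ad', esym bb', esym bc', esym cb', esym cc',
  esym da', esym dd').
do ![split].
all: rewrite !(mulrDl, mulrDr) !pureM ?nf -?(scale_purel, scale_purer).
all: lincomb R.
all: by ring: lK.
Qed.

Lemma link_antipode (A : algebraType R) (a b c d a' b' c' d' : A) :
  linkP a b c d a' b' c' d' ->
  @linkP A^c d (- (q%:S * b)) (- (q^-1%:S * c)) a
             d' (- (q%:S * b')) (- (q^-1%:S * c')) a'.
Proof.
case=> -[b'a ac' a'b bd'] [ca' d'c db' c'd] [aa' ad' bb' bc'] [cb' cc' da' dd'].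
have c'a := scalar_flip lU ac'; have d'b := scalar_flip lU bd'.
have a'c := scalar_flip lU ca'; have b'd := scalar_flip lU db'.
have nf := (b'a, c'a, a'b, d'b, a'c, d'c, b'd, c'd,
  esym aa', esym ad', esym bb', esym bc', esym cb', esym cc',
  esym da', esym dd',
  @mul_scalarl R A).
have ms (u : A) k v : u * (k%:S * v) = k%:S * (u * v) := mul_scalarr k u v.
have sr := (ms a, ms b, ms c, ms d, ms a', ms b', ms c', ms d').
do ![split].
all: try apply: converseS; try apply: converseE.
all: rewrite ?(mulrN, mulNr, opprK) ?(nf, sr); lincomb R.
all: by ring: lK.
Qed.

Lemma comul_satisfies : satisfies comul_gen lorentz_rels.
Proof.
apply: satisfies_cat; last apply: satisfies_cat.
- by apply: slq_satisfies; rewrite /= !sum2; exact: slq_comul x_slq.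
- by apply: slq_satisfies; rewrite /= !sum2; exact: slq_comul y_slq.
- by apply: link_satisfies; rewrite /= !sum2; exact: link_comul xy_link.
Qed.

Lemma antipode_satisfies : satisfies antipode_gen lorentz_rels.
Proof.
apply: satisfies_cat; last apply: satisfies_cat.
- by apply: slq_satisfies; exact: slq_antipode x_slq.
- by apply: slq_satisfies; exact: slq_antipode y_slq.
- by apply: link_satisfies; exact: link_antipode xy_link.
Qed.

Definition comul : {alghom Lorentz -> Lorentz \ox Lorentz} :=
  lift comul_satisfies.
Definition counit : {alghom Lorentz -> R^o} := lift counit_satisfies.
Definition antipode : Lorentz -> Lorentz := lift antipode_satisfies.

Lemma comul_x i j : comul (xgen i j) = \sum_k xgen i k \ox xgen k j.
Proof. exact: (lift_gen comul_satisfies (GX i j)). Qed.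
Lemma comul_y i j : comul (ygen i j) = \sum_k ygen i k \ox ygen k j.
Proof. exact: (lift_gen comul_satisfies (GY i j)). Qed.
Lemma counit_x i j : counit (xgen i j) = (i == j)%:R.
Proof. exact: (lift_gen counit_satisfies (GX i j)). Qed.
Lemma counit_y i j : counit (ygen i j) = (i == j)%:R.
Proof. exact: (lift_gen counit_satisfies (GY i j)). Qed.
Lemma antipode_x i j : antipode (xgen i j) = antipode_mx xgen i j.
Proof. exact: (lift_gen antipode_satisfies (GX i j)). Qed.
Lemma antipode_y i j : antipode (ygen i j) = antipode_mx ygen i j.
Proof. exact: (lift_gen antipode_satisfies (GY i j)). Qed.
Lemma antipodeM u v : antipode (u * v) = antipode v * antipode u.
Proof. exact: (rmorphM (lift antipode_satisfies)). Qed.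

End Definitions.

(** * Comodule algebras *)

Definition left_comodule_algebra (R : comPzRingType) (H A : algebraType R)
    (Delta : {alghom H -> H \ox H}) (eps : {alghom H -> R^o})
    (rho : {alghom A -> H \ox A}) : Prop :=
  (forall u, tens_assoc (tens_map Delta idfun (rho u))
             = tens_map idfun rho (rho u)) /\
  (forall u, tens_unitl (tens_map eps idfun (rho u)) = u).

(** * Ground rings *)

(* The Laurent polynomial ring [C[q, q^-1, l, l^-1]], as the ring of the
   fractions of [C[q][l]] whose denominator is a power of [q * l]. *)
Section Laurent.
Variable C : fieldType.

Local Notation K := {fraction {poly {poly C}}}.
Definition qfrac : K := tofrac ('X%:P).
Definition lfrac : K := tofrac 'X.

Definition laurent_pred : {pred K} :=
  fun f => `[< exists n (p : {poly {poly C}}),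
                 f * (qfrac * lfrac) ^+ n = tofrac p >].

Lemma laurent_subring : subring_closed laurent_pred.
Proof.
have [w E] : exists w, qfrac * lfrac = tofrac w.
  by exists ('X%:P * 'X); rewrite tofracM.
split.
- by apply/asboolP; exists 0%N, 1; rewrite expr0 mulr1 rmorph1.
- move=> f g /asboolP[n [p fE]] /asboolP[m [r gE]]; apply/asboolP.
  exists (n + m)%N, (p * w ^+ m - r * w ^+ n).
  by rewrite tofracB !tofracM !tofracXn -E -fE -gE exprD; ring.
- move=> f g /asboolP[n [p fE]] /asboolP[m [r gE]]; apply/asboolP.
  by exists (n + m)%N, (p * r); rewrite tofracM -fE -gE exprD; ring.
Qed.

Record laurent : Type := Laurent {
  laurent_val : K;
  laurent_valP : laurent_val \in laurent_pred
}.
HB.instance Definition _ := [isSub for laurent_val].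
HB.instance Definition _ := [Choice of laurent by <:].
HB.instance Definition _ :=
  GRing.isSubringClosed.Build K laurent_pred laurent_subring.
HB.instance Definition _ := [SubChoice_isSubComNzRing of laurent by <:].

Definition laurent_unit : {pred laurent} := fun f => `[< exists g, g * f = 1 >].
Definition laurent_inv (f : laurent) : laurent :=
  if pselect (exists g, g * f = 1) is left fU then projT1 (cid fU) else f.

Lemma laurent_mulVx : {in laurent_unit, left_inverse 1 laurent_inv *%R}.
Proof.
move=> f /asboolP fU; rewrite /laurent_inv.
by case: pselect => // fU'; case: cid.
Qed.
Lemma laurent_unitPl (f g : laurent) : g * f = 1 -> laurent_unit f.
Proof. by move=> gf; apply/asboolP; exists g. Qed.
Lemma laurent_invr_out : {in [predC laurent_unit], laurent_inv =1 id}.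
Proof.
move=> f; rewrite /laurent_inv; case: pselect => // fU /negP[].
exact/asboolP.
Qed.
HB.instance Definition _ := GRing.ComNzRing_hasMulInverse.Build laurent
  laurent_mulVx laurent_unitPl laurent_invr_out.

Lemma qfrac_laurent : qfrac \in laurent_pred.
Proof. by apply/asboolP; exists 0%N, ('X%:P); rewrite expr0 mulr1. Qed.
Lemma lfrac_laurent : lfrac \in laurent_pred.
Proof. by apply/asboolP; exists 0%N, 'X; rewrite expr0 mulr1. Qed.

Definition qvar : laurent := Laurent qfrac_laurent.
Definition lvar : laurent := Laurent lfrac_laurent.

Lemma qvar_unit : qvar \is a GRing.unit.
Proof.
have q0 : qfrac != 0 by rewrite tofrac_eq0 polyC_eq0 polyX_eq0.
have qV : qfrac^-1 \in laurent_pred.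
  by apply/asboolP; exists 1%N, 'X; rewrite expr1 (mulKf q0).
apply/asboolP; exists (Laurent qV); apply: val_inj.
by rewrite rmorphM rmorph1; exact: (mulVf q0).
Qed.
Lemma lvar_unit : lvar \is a GRing.unit.
Proof.
have l0 : lfrac != 0 by rewrite tofrac_eq0 polyX_eq0.
have lV : lfrac^-1 \in laurent_pred.
  by apply/asboolP; exists 1%N, ('X%:P); rewrite expr1 mulrC (mulfK l0).
apply/asboolP; exists (Laurent lV); apply: val_inj.
by rewrite rmorphM rmorph1; exact: (mulVf l0).
Qed.

End Laurent.

(* The two admissible choices of the ground ring and of the two deformation
   constants, over the complex numbers [F[i]]. *)
Inductive ground (F : realType) : forall R : comUnitRingType, R -> R -> Prop :=
| ground_complex (q l : F[i]) : q != 0 -> l != 0 -> @ground F F[i] q l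
| ground_indeterminates : @ground F (laurent F[i]) (qvar _) (lvar _).

(* Main.v *)
(* In [G (x) M] the entries of [x] and [y] commute with the generators [t] of
   [M], and the link relations commute the entries of [x] past those of [y] up
   to powers of [l].  The product of two generators of the coaction is thus a
   combination of terms [(y y') (x x') (t t')], each factor of which has a
   normal form; comparing coefficients verifies the relations of [M] and the
   invariance of the metric.  The comodule axioms are identities between
   algebra morphisms, hence need only be checked on generators, where they
   follow from [Delta S = (S (x) S) Delta^op] and [eps S = eps]. *)
Require Import Defs.
From mathcomp Require Import all_boot all_order all_algebra.
From mathcomp Require Import ring.
From mathcomp Require Import reals complex.

Set Implicit Arguments.
Unset Strict Implicit.
Unset Printing Implicit Defensive.

Import GRing.Theory.
Local Open Scope ring_scope.

(** * Minkowski relations and metric for the coacted generators *)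

Definition minkP (R : comUnitRingType) (q l : R) (A : algebraType R)
    (t11 t12 t21 t22 : A) : Prop :=
  [/\ t11 * t12 = (q * l)%:S * (t12 * t11),
      t12 * t22 = (q^-1 * l)%:S * (t22 * t12),
      t12 * t21 = t21 * t12 + (l * (q^-1 - q))%:S * (t11 * t22),
      t11 * t22 = t22 * t11
   & [/\ t11 * t21 = (q^-1 * l^-1)%:S * (t21 * t11)
      & t21 * t22 = (q * l^-1)%:S * (t22 * t21)]].

Section MiddleSwap.
Variables (R : comPzRingType) (A : algebraType R).
Implicit Types x y u v : A.

(** The outer factors stay quantified in the conclusion, so that each commutation rule becomes a
    rewrite rule acting only at the junction of two bracketed products. *)
Lemma mulr_swap_mid x y :
  x * y = y * x -> forall u v, (u * x) * (y * v) = (u * y) * (x * v).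
Proof. by move=> xy u v; rewrite mulrA -(mulrA u) xy !mulrA. Qed.

Lemma mulr_qswap_mid (k : R) x y : x * y = k%:S * (y * x) ->
  forall u v, (u * x) * (y * v) = k%:S * ((u * y) * (x * v)).
Proof.
by move=> xy u v; rewrite mulrA -(mulrA u) xy mul_scalarr mul_scalarl !mulrA.
Qed.

End MiddleSwap.

(* The tensor factors are embedded as commuting subalgebras of one algebra,
   so that [(y * x) \ox t] becomes the triple product [y * x * t]. *)
Section CoactedMinkowski.
Variables (R : comUnitRingType) (q l : R) (A : algebraType R).
Hypotheses (qU : q \is a GRing.unit) (lU : l \is a GRing.unit).
Variables (a b c d a' b' c' d' t11 t12 t21 t22 : A).
Hypotheses (xP : slqP q a b c d) (yP : slqP q a' b' c' d')
  (xyP : linkP l a b c d a' b' c' d') (tP : minkP q l t11 t12 t21 t22)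
  (tC : forall t y x, t \in [:: t11; t12; t21; t22] ->
     y \in [:: a'; b'; c'; d'] -> x \in [:: a; b; c; d] ->
     t * (y * x) = y * x * t).

(* The images of the generators of the first and second column; [u, v] is the
   corresponding row of [y]. *)
Definition coact_col1 (u v : A) : A :=
  u * d * t11 - q^-1%:S * (u * c * t12)
  + v * d * t21 - q^-1%:S * (v * c * t22).
Definition coact_col2 (u v : A) : A :=
  - (q%:S * (u * b * t11)) + u * a * t12
  - q%:S * (v * b * t21) + v * a * t22.

Let qK : q * q^-1 = 1. Proof. exact: divrr. Qed.
Let lK : l * l^-1 = 1. Proof. exact: divrr. Qed.

(** Here [z * w] is moved as a single middle factor: the part in [y] and [x] is split from the part
    in [t] before its own factors are sorted. *)
Let tM y x t z w s : t \in [:: t11; t12; t21; t22] ->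
  z \in [:: a'; b'; c'; d'] -> w \in [:: a; b; c; d] ->
  y * x * t * (z * w * s) = (y * x) * (z * w) * (t * s).
Proof. by move=> tT zY wX; apply/mulr_swap_mid/tC. Qed.

(** The left factor is required to be a product, because the general [mul_scalarr] also matches a
    scalar there and would exchange nested scalars endlessly when iterated. *)
Let mulM_scalarr (k : R) u u' v :
  u * u' * (k%:S * v) = k%:S * (u * u' * v) :> A.
Proof. exact: mul_scalarr. Qed.

Let mulMM_scalarr (k : R) u u' u'' v :
  u * u' * u'' * (k%:S * v) = k%:S * (u * u' * u'' * v) :> A.
Proof. exact: mul_scalarr. Qed.

(** Conjunctions are repackaged as tuples, which serve as multirules. Sorting puts [a], [b], [c],
    [d] in this order and eliminates both [a * d] and [d * a]; [nft] sorts into the order [t22],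
    [t21], [t12], [t11]. *)
Let nfx := let: And5 ba ca db dc (And3 cb ad da) := slq_nf qU xP in
  (ba, ca, db, dc, cb, ad, da).
Let nfy := let: And5 ba ca db dc (And3 cb ad da) := slq_nf qU yP in
  (ba, ca, db, dc, cb, ad, da).
Let nft := let: And5 t1112 t1222 t1221 t1122 (conj t1121 t2122) := tP in
  (t1112, t1222, t1221, t1122, t1121, t2122).
(** One rule for each of the sixteen pairs of an entry of [x] followed by an entry of [y], moving
    the latter to the left; link relations stated in the other direction are inverted by
    [scalar_flip]. *)
Let swaps :=
  let: And4 (And4 b'a ac' a'b bd') (And4 ca' d'c db' c'd)
    (And4 aa' ad' bb' bc') (And4 cb' cc' da' dd') := xyP in
  (mulr_qswap_mid (scalar_flip lU b'a), mulr_qswap_mid ac',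
   mulr_qswap_mid (scalar_flip lU a'b), mulr_qswap_mid bd',
   mulr_qswap_mid ca', mulr_qswap_mid (scalar_flip lU d'c),
   mulr_qswap_mid db', mulr_qswap_mid (scalar_flip lU c'd),
   mulr_swap_mid aa', mulr_swap_mid ad', mulr_swap_mid bb',
   mulr_swap_mid bc', mulr_swap_mid cb', mulr_swap_mid cc',
   mulr_swap_mid da', mulr_swap_mid dd').

Ltac by_normal_form :=
  rewrite /coact_col1 /coact_col2 !(mulrDl, mulrDr, mulrN, mulNr);
  rewrite ?(opprK, opprD) !mul_scalarl !mulMM_scalarr;
  rewrite !tM ?(inE, eqxx, orbT) // !swaps !(nfx, nfy, nft);
  (* The rules for [a * d], [d * a] and [t12 * t21] have sums on the right, so a second expansion is
     due. *)
  rewrite ?(mulrDl, mulrDr, mulr1, mul1r) ?mul_scalarl ?mulM_scalarr;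
  rewrite ?mul_scalarl; lincomb R; by ring: qK lK.

Lemma coact_11_12 :
  coact_col1 a' b' * coact_col2 a' b'
  = (q * l)%:S * (coact_col2 a' b' * coact_col1 a' b').
Proof. by_normal_form. Qed.

Lemma coact_12_22 :
  coact_col2 a' b' * coact_col2 c' d'
  = (q^-1 * l)%:S * (coact_col2 c' d' * coact_col2 a' b').
Proof. by_normal_form. Qed.

Lemma coact_12_21 :
  coact_col2 a' b' * coact_col1 c' d' = coact_col1 c' d' * coact_col2 a' b'
    + (l * (q^-1 - q))%:S * (coact_col1 a' b' * coact_col2 c' d').
Proof. by_normal_form. Qed.

Lemma coact_11_22 :
  coact_col1 a' b' * coact_col2 c' d' = coact_col2 c' d' * coact_col1 a' b'.
Proof. by_normal_form. Qed.

Lemma coact_11_21 :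
  coact_col1 a' b' * coact_col1 c' d'
  = (q^-1 * l^-1)%:S * (coact_col1 c' d' * coact_col1 a' b').
Proof. by_normal_form. Qed.

Lemma coact_21_22 :
  coact_col1 c' d' * coact_col2 c' d'
  = (q * l^-1)%:S * (coact_col2 c' d' * coact_col1 c' d').
Proof. by_normal_form. Qed.

(** The constant terms of [a * d] and [d * a] in both copies, that is the two determinant relations,
    leave the metric itself; all terms that still contain an entry of [x] or [y] cancel. *)
Lemma coact_metric :
  coact_col2 a' b' * coact_col1 c' d'
    - (q^-1 * l)%:S * (coact_col1 a' b' * coact_col2 c' d')
  = t12 * t21 - (q^-1 * l)%:S * (t11 * t22).
Proof. by_normal_form. Qed.

Lemma coact_minkP : minkP q l (coact_col1 a' b') (coact_col2 a' b')
  (coact_col1 c' d') (coact_col2 c' d').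
Proof.
by split; [exact: coact_11_12 | exact: coact_12_22 | exact: coact_12_21
  | exact: coact_11_22 | split; [exact: coact_11_21 | exact: coact_21_22]].
Qed.

End CoactedMinkowski.

(** * Algebra morphisms and their determination by generators *)

Definition is_alghom (R : comPzRingType) (A B : algebraType R) (f : A -> B) :
    Prop :=
  [/\ zmod_morphism f, monoid_morphism f & forall k, f k%:S = k%:S].

Section IsAlghom.
Variables (R : comPzRingType) (A B C : algebraType R).

Lemma alghom_is_alghom (f : {alghom A -> B}) : is_alghom f.
Proof.
split=> [u v||k]; [exact: rmorphB | | exact: alghom_scalar].
by split; [exact: rmorph1 | exact: rmorphM].
Qed.

(** The sides of the comodule axioms are composites of plain functions; the predicate handles them
    without a bundled structure for each. *)
Lemma is_alghom_comp (f : B -> C) (g : A -> B) :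
  is_alghom f -> is_alghom g -> is_alghom (f \o g).
Proof.
move=> [fB [f1 fM] fS] [gB [g1 gM] gS]; split=> [u v||k] /=.
- by rewrite gB fB.
- by split=> [|u v] /=; rewrite ?g1 ?f1 // gM fM.
- by rewrite gS fS.
Qed.

Lemma is_alghom0 (f : A -> B) : is_alghom f -> f 0 = 0.
Proof. by case=> fB _ _; rewrite -(subrr 0) fB subrr. Qed.

Lemma is_alghomN (f : A -> B) : is_alghom f -> {morph f : u / - u}.
Proof.
by move=> fH u; have [fB _ _] := fH; rewrite -sub0r fB is_alghom0 ?sub0r.
Qed.

Lemma is_alghomD (f : A -> B) : is_alghom f -> {morph f : u v / u + v}.
Proof.
move=> fH u v; have [fB _ _] := fH.
by rewrite -{1}[v]opprK fB is_alghomN // opprK.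
Qed.

End IsAlghom.

(** Uniqueness in the universal property: by [weval_gen] the class of a word is its evaluation at
    the generators, so induction on the word applies. *)
Lemma presented_ext (R : comPzRingType) (X : Type)
    (rels : seq (word R X * word R X)) (A : algebraType R)
    (f g : presented rels -> A) :
  is_alghom f -> is_alghom g ->
  (forall x, f (gen rels x) = g (gen rels x)) -> f =1 g.
Proof.
move=> fH gH fg; have [_ [f1 fM] fS] := fH; have [_ [g1 gM] gS] := gH.
elim/quotW => w; rewrite -weval_gen.
elim: w => [x|||u IHu|u IHu v IHv|u IHu v IHv|k] /=.
- exact: fg.
- by rewrite !is_alghom0.
- by rewrite f1 g1.
- by rewrite !is_alghomN // IHu.
- by rewrite !is_alghomD // IHu IHv.
- by rewrite fM gM IHu IHv.
- by rewrite fS gS.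
Qed.

(** * Canonical maps between tensor products as algebra morphisms *)

Section TensorMorphisms.
Variable R : comPzRingType.

Lemma pureNl (A B : algebraType R) (a : A) (b : B) : (- a) \ox b = - (a \ox b).
Proof.
have p0 : (0 : A) \ox b = 0 by apply: (addrI (0 \ox b)); rewrite -pureDl !addr0.
by apply: (addrI (a \ox b)); rewrite -pureDl !subrr p0.
Qed.

Lemma pureBl (A B : algebraType R) (a a' : A) (b : B) :
  (a - a') \ox b = a \ox b - a' \ox b.
Proof. by rewrite pureDl pureNl. Qed.

Lemma pureBr (A B : algebraType R) (a : A) (b b' : B) :
  a \ox (b - b') = a \ox b - a \ox b'.
Proof. by apply: (addIr (a \ox b')); rewrite -pureDr !subrK. Qed.

Lemma pureNr (A B : algebraType R) (a : A) (b : B) : a \ox (- b) = - (a \ox b).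
Proof.
by apply: (addIr (a \ox b)); rewrite -pureDr !addNr -(subrr b) pureBr subrr.
Qed.

Lemma scalar_tens (A B : algebraType R) (k : R) : k%:S = k%:S \ox 1 :> A \ox B.
Proof. by rewrite -[LHS]mulr1 scale_purel mulr1. Qed.

(** Pure tensors generate all tensors under subtraction ([tens_ind]), and both sides are
    biadditive. *)
Lemma tens_mul_ext (A B C : algebraType R) (f : A \ox B -> C) :
  zmod_morphism f ->
  (forall a b a' b', f (a \ox b * (a' \ox b')) = f (a \ox b) * f (a' \ox b')) ->
  {morph f : u v / u * v}.
Proof.
move=> fB fM u v; elim/tens_ind: u => [a b|u u' IH IH'].
  elim/tens_ind: v => [a' b'|v v' IH IH']; first exact: fM.
  by rewrite mulrBr !fB IH IH' mulrBr.
by rewrite mulrBl !fB IH IH' mulrBl.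
Qed.

Section TensMap.
Variables (A B A' B' : algebraType R).
Variables (f : {alghom A -> A'}) (g : {alghom B -> B'}).

Lemma tens_map_pure a b : tens_map f g (a \ox b) = f a \ox g b.
Proof. exact: tlift_pure. Qed.

Lemma tens_map_is_alghom : is_alghom (tens_map f g).
Proof.
have fgB : zmod_morphism (tens_map f g) by exact: tliftB.
split=> // [|k]; last first.
  by rewrite !scalar_tens tens_map_pure alghom_scalar rmorph1.
split; first by rewrite -[1]pure1 tens_map_pure !rmorph1.
apply: (tens_mul_ext fgB) => a b a' b'.
by rewrite pureM !tens_map_pure !rmorphM pureM.
Qed.
End TensMap.

Section TensAssoc.
Variables A B C : algebraType R.
Local Notation assoc := (@tens_assoc R A B C).

Lemma tens_assoc_pure a b c : assoc (a \ox b \ox c) = a \ox (b \ox c).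
Proof. by rewrite /tens_assoc !tlift_pure. Qed.

Lemma tens_assoc_is_alghom : is_alghom assoc.
Proof.
have assocB : zmod_morphism assoc by exact: tliftB.
split=> // [|k]; last by rewrite !scalar_tens tens_assoc_pure.
split; first by rewrite -[1]pure1 -{1}[1]pure1 tens_assoc_pure.
apply: (tens_mul_ext assocB) => u c v c'; rewrite pureM.
(* The left components [u] and [v] are themselves tensors, so a second reduction to pure ones is
   needed. *)
elim/tens_ind: u => [a b|u u' IH IH'].
  elim/tens_ind: v => [a' b'|v v' IH IH'].
    by rewrite pureM !tens_assoc_pure !pureM.
  by rewrite mulrBr !pureBl !assocB IH IH' mulrBr.
by rewrite mulrBl !pureBl !assocB IH IH' mulrBl.
Qed.
End TensAssoc.

Section TensUnit.
Variable A : algebraType R.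
Local Notation unitl := (@tens_unitl R A).

Lemma tens_unitl_pure k a : unitl (k \ox a) = (k : R)%:S * a.
Proof. exact: tlift_pure. Qed.

Lemma tens_unitl_is_alghom : is_alghom unitl.
Proof.
have unitlB : zmod_morphism unitl by exact: tliftB.
split=> // [|k]; last by rewrite scalar_tens tens_unitl_pure mulr1.
split; first by rewrite -pure1 tens_unitl_pure rmorph1 mulr1.
apply: (tens_mul_ext unitlB) => k a k' a'.
by rewrite pureM !tens_unitl_pure rmorphM !mul_scalarl mul_scalarr.
Qed.
End TensUnit.

End TensorMorphisms.

(** * Relations transported to the two factors of a tensor product *)

Section Embeddings.
Variables (R : comUnitRingType) (q l : R) (A B : algebraType R).

Lemma slqP_pure (a b c d : A) : slqP q a b c d ->
  slqP q (a \ox (1 : B)) (b \ox 1) (c \ox 1) (d \ox 1).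
Proof.
case=> ab ac bd cd [ad bc det].
by do ![split]; rewrite !pureM mulr1 ?scale_purel -?pureBl ?pure1;
  congr (_ \ox _).
Qed.

Lemma linkP_pure (a b c d a' b' c' d' : A) : linkP l a b c d a' b' c' d' ->
  linkP l (a \ox (1 : B)) (b \ox 1) (c \ox 1) (d \ox 1)
          (a' \ox 1) (b' \ox 1) (c' \ox 1) (d' \ox 1).
Proof.
case=> -[? ? ? ?] [? ? ? ?] [? ? ? ?] [? ? ? ?].
by do ![split]; rewrite !pureM mulr1 ?scale_purel; congr (_ \ox _).
Qed.

Lemma minkP_pure (t11 t12 t21 t22 : B) : minkP q l t11 t12 t21 t22 ->
  minkP q l ((1 : A) \ox t11) (1 \ox t12) (1 \ox t21) (1 \ox t22).
Proof.
case=> ? ? ? ? [? ?].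
by do ![split]; rewrite !pureM mulr1 ?scale_purer -?pureDr; congr (_ \ox _).
Qed.

End Embeddings.

(** Replaces an index by the terms [i1] and [i2] themselves, on which the tests in [antipode_mx]
    compute. *)
Lemma ord2_ind (P : 'I_2 -> Prop) : P i1 -> P i2 -> forall i, P i.
Proof.
move=> P1 P2 [[|[|//]] i2']; first by congr P: P1; apply: val_inj.
by congr P: P2; apply: val_inj.
Qed.

(** * The coaction and the comodule axioms *)

Section Coaction.
Variables (R : comUnitRingType) (q l : R).
Hypotheses (qU : q \is a GRing.unit) (lU : l \is a GRing.unit).

Lemma mink_satisfies (X : algebraType R) (f : 'I_2 * 'I_2 -> X) :
  minkP q l (f (i1, i1)) (f (i1, i2)) (f (i2, i1)) (f (i2, i2)) ->
  satisfies f (mink_rels q l).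
Proof. by case=> ? ? ? ? [? ?]; do ![split]. Qed.

Lemma tgen_minkP : minkP q l (tgen q l i1 i1) (tgen q l i1 i2)
  (tgen q l i2 i1) (tgen q l i2 i2).
Proof.
have /= := gen_satisfies (mink_rels q l).
by do 6![case=> ?]; move=> _; do ![split].
Qed.

Local Notation G := (Lorentz q l).
Local Notation M := (Mink q l).
Local Notation x := (xgen q l).
Local Notation y := (ygen q l).
Local Notation t := (tgen q l).
Local Notation xl i j := (x i j \ox (1 : M)).
Local Notation yl i j := (y i j \ox (1 : M)).
Local Notation tr i j := ((1 : G) \ox t i j).

(** The explicit matrix stands in for the antipode, which keeps the entries of S(x) computable;
    [antipode_x] identifies the two. *)
Definition coact_gen (p : 'I_2 * 'I_2) : G \ox M :=
  \sum_s \sum_r (y p.1 s * antipode_mx x r p.2) \ox t s r.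

(** The first column of S(x) involves only [c] and [d], the second only [a] and [b]. *)
Let col1 := coact_col1 q (xl i2 i1) (xl i2 i2)
  (tr i1 i1) (tr i1 i2) (tr i2 i1) (tr i2 i2).
Let col2 := coact_col2 q (xl i1 i1) (xl i1 i2)
  (tr i1 i1) (tr i1 i2) (tr i2 i1) (tr i2 i2).

Lemma coact_gen_col1 i : coact_gen (i, i1) = col1 (yl i i1) (yl i i2).
Proof.
rewrite /coact_gen !sum2 /antipode_mx /= /col1 /coact_col1.
rewrite !mulrN !mul_scalarr !pureNl -!scale_purel !pureM !mulr1 !mul1r.
by rewrite addrA.
Qed.

Lemma coact_gen_col2 i : coact_gen (i, i2) = col2 (yl i i1) (yl i i2).
Proof.
rewrite /coact_gen !sum2 /antipode_mx /= /col2 /coact_col2.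
rewrite !mulrN !mul_scalarr !pureNl -!scale_purel !pureM !mulr1 !mul1r.
by rewrite addrA.
Qed.

Let tyx_comm s g z : s \in [:: tr i1 i1; tr i1 i2; tr i2 i1; tr i2 i2] ->
  g \in [:: yl i1 i1; yl i1 i2; yl i2 i1; yl i2 i2] ->
  z \in [:: xl i1 i1; xl i1 i2; xl i2 i1; xl i2 i2] ->
  s * (g * z) = g * z * s.
Proof.
rewrite !inE => /or4P sT /or4P gY /or4P zX.
by case: sT => /eqP->; case: gY => /eqP->; case: zX => /eqP->;
  rewrite !pureM !mulr1 !mul1r.
Qed.

Let xlP := slqP_pure M (x_slq q l).
Let ylP := slqP_pure M (y_slq q l).
Let xylP := linkP_pure M (xy_link q l).
Let trP := minkP_pure G tgen_minkP.

Lemma coact_gen_minkP : minkP q l (coact_gen (i1, i1)) (coact_gen (i1, i2))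
  (coact_gen (i2, i1)) (coact_gen (i2, i2)).
Proof.
rewrite !coact_gen_col1 !coact_gen_col2.
exact: (coact_minkP qU lU xlP ylP xylP trP tyx_comm).
Qed.

Definition coaction : {alghom M -> G \ox M} :=
  Defs.lift (mink_satisfies coact_gen_minkP).

Lemma coaction_tgen i j : coaction (t i j) = coact_gen (i, j).
Proof. exact: (Defs.lift_gen (mink_satisfies coact_gen_minkP) (i, j)). Qed.

Lemma coaction_Qmetric : coaction (Qmetric q l) = 1 \ox Qmetric q l.
Proof.
have cM u v : coaction (u * v) = coaction u * coaction v by exact: rmorphM.
have cB u v : coaction (u - v) = coaction u - coaction v by exact: rmorphB.
rewrite /Qmetric cB !cM alghom_scalar !coaction_tgen.
rewrite !coact_gen_col1 !coact_gen_col2 /col1 /col2.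
apply: (etrans (coact_metric qU lU xlP ylP xylP trP tyx_comm)).
by rewrite !pureM mulr1 scale_purer -pureBr.
Qed.

(** The antipode reverses the tensor factors. In the diagonal entries its coefficients [q] and
    [q^-1] meet in one term, whence [qK]. *)
Lemma comul_antipode_mx i j :
  comul qU lU (antipode_mx x i j)
  = \sum_k antipode_mx x k j \ox antipode_mx x i k.
Proof.
have qK : q * q^-1 = 1 by exact: divrr.
have cS k u : comul qU lU (k%:S * u) = k%:S * comul qU lU u.
  by rewrite rmorphM /= alghom_scalar.
have cN u : comul qU lU (- u) = - comul qU lU u by exact: rmorphN.
elim/ord2_ind: i; elim/ord2_ind: j; rewrite /antipode_mx sum2 /=.
all: rewrite ?cN ?cS comul_x sum2 ?(pureNl, pureNr).
all: rewrite -?(scale_purel, scale_purer); lincomb R.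
all: by ring: qK.
Qed.

Lemma counit_antipode_mx i j :
  counit q l (antipode_mx x i j) = (i == j)%:R.
Proof.
by elim/ord2_ind: i; elim/ord2_ind: j;
  rewrite /antipode_mx ?rmorphN ?rmorphM /= counit_x ?mulr0 ?oppr0.
Qed.

Lemma coaction_coassoc u :
  tens_assoc (tens_map (comul qU lU) idfun (coaction u))
  = tens_map idfun coaction (coaction u).
Proof.
have lhsH : is_alghom (@tens_assoc R G G M \o
    (tens_map (comul qU lU) idfun \o coaction)).
  apply: is_alghom_comp; first exact: tens_assoc_is_alghom.
  apply: is_alghom_comp; first exact: tens_map_is_alghom.
  exact: alghom_is_alghom.
have rhsH : is_alghom (tens_map (@idfun G) coaction \o coaction).
  apply: is_alghom_comp; first exact: tens_map_is_alghom.
  exact: alghom_is_alghom.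
apply: (presented_ext lhsH rhsH) => -[i j] /=.
have cM v w : comul qU lU (v * w) = comul qU lU v * comul qU lU w.
  exact: rmorphM.
rewrite -/(tgen q l i j) coaction_tgen /coact_gen !sum2 /=.
rewrite !(is_alghomD (tens_map_is_alghom _ _)) !tens_map_pure.
rewrite !(is_alghomD (tens_assoc_is_alghom _ _ _)).
rewrite !cM !comul_antipode_mx !comul_y !coaction_tgen /coact_gen !sum2 /=.
rewrite !(mulrDl, mulrDr) !pureM.
rewrite !(pureDl, pureDr) !(is_alghomD (tens_assoc_is_alghom _ _ _)).
rewrite !tens_assoc_pure.
(* Both sides are now the sum over k, m, s, r of [y i k * S(x) m j \ox (y k s * S(x) r m \ox t s
   r)], up to the order of the terms. *)
by lincomb R; ring.
Qed.

Lemma coaction_counit u :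
  tens_unitl (tens_map (counit q l) idfun (coaction u)) = u.
Proof.
have lhsH : is_alghom (@tens_unitl R M \o
    (tens_map (counit q l) idfun \o coaction)).
  apply: is_alghom_comp; first exact: tens_unitl_is_alghom.
  apply: is_alghom_comp; first exact: tens_map_is_alghom.
  exact: alghom_is_alghom.
have rhsH : is_alghom (@idfun M) by exact: alghom_is_alghom.
apply: (presented_ext lhsH rhsH) => -[i j] /=.
have cM v w : counit q l (v * w) = counit q l v * counit q l w.
  exact: rmorphM.
rewrite -/(tgen q l i j) coaction_tgen /coact_gen !sum2 /=.
rewrite !(is_alghomD (tens_map_is_alghom _ _)) !tens_map_pure.
rewrite !(is_alghomD (tens_unitl_is_alghom _)) !tens_unitl_pure !cM.
rewrite !counit_antipode_mx !counit_y.
(* The coefficient of [t s r] is the product of the Kronecker deltas of (i, s) and (r, j), so only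
   [t i j] survives. *)
by elim/ord2_ind: i; elim/ord2_ind: j;
  rewrite /= ?(mulr0, mul0r, mulr1, rmorph0, rmorph1, mul1r, addr0, add0r).
Qed.

End Coaction.

Theorem proposition6p2 (F : realType) (R : comUnitRingType) (q l : R)
    (qU : q \is a GRing.unit) (lU : l \is a GRing.unit)
    (groundR : ground F q l) :
  exists rho : {alghom Mink q l -> Lorentz q l \ox Mink q l},
    [/\ forall i j : 'I_2,
          rho (tgen q l i j)
          = \sum_s \sum_r
              (ygen q l i s * antipode qU lU (xgen q l r j)) \ox tgen q l s r,
        left_comodule_algebra (comul qU lU) (counit q l) rho
      & rho (Qmetric q l) = 1 \ox Qmetric q l].
Proof.
exists (coaction qU lU); split; last exact: coaction_Qmetric.
  move=> i j; rewrite coaction_tgen; apply: eq_bigr => s _.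
  by apply: eq_bigr => r _; rewrite antipode_x.
by split=> u; [exact: coaction_coassoc | exact: coaction_counit].
Qed.
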